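(* Let $p$ be a prime number and $q=p^h$ a power of $p$. Let $\operatorname{Tr}:\mathbb F_q\to\mathbb F_p$ be the absolute trace function, and equip $\mathbb F_p$ with the total order $<$ obtained by identifying its elements with the integers $0,\dots,p-1$. Then the set $$L=\{(x,y)\in\mathbb F_q^2 : \operatorname{Tr}(x)<\operatorname{Tr}(y)\}$$ of points in $\mathrm{AG}(2,q)$ is inequidistributed from exactly 3 directions: $(0)$, $(1)$, and $(\infty)$. Moreover, every set of points that is inequidistributed from exactly 3 directions in $\mathrm{AG}(2,q)$ is affinely equivalent to the union of $L$ and some (possibly no) parallel lines that are disjoint from $L$.
   Context: $\mathrm{AG}(2,q)$ is the Desarguesian affine plane with point set $\mathbb F_q^2$. Its directions are $(d)$ with $d\in\mathbb F_q\cup\{\infty\}$: for $d\in\mathbb F_q$ the lines with direction $(d)$ are the lines $Y=dX+b$, and the lines with direction $(\infty)$ are the lines $X=a$. A set $S$ of points is equidistributed from direction $(d)$ if all lines with direction $(d)$ intersect $S$ in the same number of points, and inequidistributed from $(d)$ otherwise. Two point sets are affinely equivalent if one is the image of the other under an affine transformation $v\mapsto Mv+b$ with $M\in\mathrm{GL}(2,q)$, $b\in\mathbb F_q^2$. *)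

(* Defs.v *)
From mathcomp Require Import all_boot all_order all_algebra all_field.
Set Implicit Arguments.
Unset Strict Implicit.
Unset Printing Implicit Defensive.
Import GRing.Theory.
Local Open Scope ring_scope.

Section AffinePlane.
Variable F : finFieldType.

Local Notation point := 'cV[F]_2.

Definition xcoord (v : point) : F := v ord0 ord0.
Definition ycoord (v : point) : F := v ord_max ord0.

(* [Some d] is the direction (d), and [None] is the direction (infinity). *)
Local Notation direction := (option F).

Definition line (d : direction) (c : F) : {set point} :=
  if d is Some m then [set v | ycoord v == m * xcoord v + c]
  else [set v | xcoord v == c].

Definition equidistributed (S : {set point}) (d : direction) : bool :=
  [forall c1, forall c2, #|S :&: line d c1| == #|S :&: line d c2|].

Definition inequidistributed (S : {set point}) (d : direction) : bool :=
  ~~ equidistributed S d.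

Definition inequidistributed_directions (S : {set point}) : {set direction} :=
  [set d | inequidistributed S d].

Definition affinely_equivalent (S T : {set point}) : Prop :=
  exists M : 'M[F]_2, exists b : point,
    M \in unitmx /\ T = [set M *m v + b | v in S].

(* The set [C] may be empty. *)
Definition union_with_disjoint_parallel_lines (L T : {set point}) : Prop :=
  exists d : direction, exists C : {set F},
    (forall c, c \in C -> [disjoint line d c & L]) /\
    T = L :|: \bigcup_(c in C) line d c.

End AffinePlane.

Section AbsoluteTrace.
Variables (F : finFieldType) (p h : nat).

(* For #|F| = p ^ h this is the absolute trace, as an element of F lying in the
   prime subfield. *)
Definition frobenius_sum (x : F) : F := \sum_(i < h) x ^+ (p ^ i).

(* The same element viewed in 'F_p; [absolute_traceE] shows that the default
   value 0 is never used when p is prime and #|F| = p ^ h. *)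
Definition absolute_trace (x : F) : 'F_p :=
  odflt 0 [pick a : 'F_p | (a : nat)%:R == frobenius_sum x].

Hypotheses (p_pr : prime p) (cardF : #|F| = (p ^ h)%N).

Let pcharF : p \in [pchar F].
Proof. exact: card_finPcharP cardF p_pr. Qed.

Lemma frobenius_sum_fixed x : frobenius_sum x ^+ p = frobenius_sum x.
Proof.
rewrite -(pFrobenius_autE pcharF) raddf_sum /=.
under eq_bigr => i _ do rewrite pFrobenius_autE -exprM -expnSr.
have h_gt0 : (0 < h)%N.
  by rewrite lt0n; apply/eqP => h0; have := finNzRing_gt1 F; rewrite cardF h0.
rewrite /frobenius_sum; case: h h_gt0 cardF => // k _ cF.
rewrite big_ord_recr [RHS]big_ord_recl /= -cF expf_card expn0 expr1 addrC.
by congr (_ + _).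
Qed.

Lemma absolute_traceE x : (absolute_trace x : nat)%:R = frobenius_sum x.
Proof.
rewrite /absolute_trace; case: pickP => [a /eqP // | no_a].
pose s := [seq ((a : nat)%:R : F) | a : 'F_p].
have injs : injective (fun a : 'F_p => (a : nat)%:R : F).
  suff le_inj (a b : 'F_p) : (a <= b)%N -> (a : nat)%:R = (b : nat)%:R :> F ->
      a = b.
    move=> a b eq_ab; case: (leqP a b) => [|/ltnW] le_ab; first exact: le_inj.
    by apply/esym/le_inj.
  move=> le_ab /esym/eqP; rewrite -subr_eq0 -natrB // -(dvdn_pcharf pcharF).
  have lt_p : (b - a < p)%N.
    apply: leq_ltn_trans (leq_subr _ _) _.
    by rewrite -[ltnRHS](Fp_cast p_pr) ltn_ord.
  have [|ba_gt0 /dvdn_leq] := posnP (b - a)%N.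
    by move/eqP; rewrite subn_eq0 => ? _; apply/ord_inj/eqP; rewrite eqn_leq le_ab.
  by move=> /(_ ba_gt0); rewrite leqNgt lt_p.
have s_uniq : uniq (frobenius_sum x :: s).
  rewrite /= map_inj_uniq ?enum_uniq // andbT; apply/negP => /mapP[a _ eq_a].
  by have := no_a a; rewrite -eq_a eqxx.
have size_P : size ('X^p - 'X : {poly F}) = p.+1.
  by rewrite size_polyDl ?size_polyXn // size_polyN size_polyX ltnS prime_gt1.
have P_neq0 : 'X^p - 'X != 0 :> {poly F} by rewrite -size_poly_eq0 size_P.
have rootP z : z ^+ p = z -> root ('X^p - 'X : {poly F}) z.
  by move=> zp; rewrite rootE !hornerE zp subrr.
have s_root : all (root ('X^p - 'X : {poly F})) (frobenius_sum x :: s).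
  rewrite /= rootP ?frobenius_sum_fixed //=; apply/allP => _ /mapP[a _ ->].
  by apply: rootP; rewrite -(pFrobenius_autE pcharF) pFrobenius_aut_nat.
have := max_poly_roots P_neq0 s_root s_uniq.
by rewrite size_P /= size_map -cardE card_Fp // ltnn.
Qed.

End AbsoluteTrace.

(* 'F_p coerces to nat through the representatives 0, ..., p - 1, so that [<] is
   the required order on 'F_p. *)
Definition trace_set (F : finFieldType) (p h : nat) : {set 'cV[F]_2} :=
  [set v | (absolute_trace p h (xcoord v) < absolute_trace p h (ycoord v))%N].

(* Main.v *)
From HB Require Import structures.
Require Import Defs.
From mathcomp Require Import all_boot all_order all_algebra all_field.
From mathcomp Require Import zify ring.
Set Implicit Arguments.
Unset Strict Implicit.
Unset Printing Implicit Defensive.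
Import GRing.Theory.
Local Open Scope ring_scope.

(** For a point [v], the lines through [v] in all directions cover [v] q + 1 times
    and every other point once. Equidistributed directions contribute a constant,
    so if only three directions are inequidistributed, then in suitable linear
    coordinates q * [(x, y) in S] = n1 x + n2 y + n3 (y - x) - K, where the n_i count
    points of S on lines.  Modulo q this is a Pexider equation: up to constants,
    n1, n2, n3 are -q/p f, q/p f, -q/p f for one additive f : F -> F_p.  As
    0 <= n_i <= q, the function n_i is determined by f and its minimum, except that
    the value 0 may be replaced by q when there are both full and empty lines; this
    happens for at most one direction, since a full and an empty line of different
    directions would meet.  The values of f then decide membership in S by a
    threshold ("carry") condition, which is the order relation defining L after a
    translation.  Finally f = Tr (a * _) for some a.

    Conversely p [X < Y] = (X - Y) - X + Y for representatives in {0, ..., p - 1},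
    which makes the line counts of L explicit. *)

(** * Carries and borrows for the representatives of ['F_p] *)

Section Fp.
Variables (p : nat) (p_pr : prime p).

Lemma ltn_Fp (a : 'F_p) : (a < p)%N.
Proof. by rewrite -[ltnRHS](Fp_cast p_pr) ltn_ord. Qed.

Lemma val_FpD (a b : 'F_p) :
  (a + b)%R = (if (a + b < p)%N then a + b else a + b - p)%N :> nat.
Proof.
(* The modulus built into ['F_p] equals [p] only because [p] is prime, hence [Fp_cast]. *)
have -> : (a + b)%R = ((a + b) %% p)%N :> nat.
  by rewrite /=; congr (_ %% _)%N; exact: Fp_cast.
have := ltn_Fp a; have := ltn_Fp b.
case: (ltnP (a + b) p) => [/modn_small -> // | ge_p lt_b lt_a].
by rewrite -[X in (X %% _)%N](subnK ge_p) modnDr modn_small //; lia.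
Qed.

Lemma val_Fp0 : (0 : 'F_p) = 0%N :> nat.
Proof. by []. Qed.

Lemma val_FpN (a : 'F_p) : (- a)%R = (if (a == 0 :> nat)%N then 0 else p - a)%N :> nat.
Proof.
have := val_FpD a (- a); rewrite subrr val_Fp0.
have := ltn_Fp a; have := ltn_Fp (- a); case: eqP; case: ifP; lia.
Qed.

Lemma val_FpN1 : (-1 : 'F_p) = p.-1 :> nat.
Proof.
have p_gt1 := prime_gt1 p_pr.
by have := val_Fp_nat p_pr 1; rewrite modn_small // val_FpN => -> /=; rewrite subn1.
Qed.

(** Subtraction of representatives borrows [p] exactly when [a < b]. Moving every term to its
    positive side avoids truncated subtraction. *)
Lemma Fp_borrow (a b : 'F_p) :
  (p * (a < b)%N + a = (a - b)%R + b)%N.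
Proof.
have := val_FpD a (- b); rewrite val_FpN.
have := ltn_Fp a; have := ltn_Fp b; case: eqP => ?; case: ifP => ?; case: ltnP; lia.
Qed.

Lemma val_FpN1B (a : 'F_p) : (-1 - a)%R = (p.-1 - a)%N :> nat.
Proof.
have := Fp_borrow (-1) a; rewrite val_FpN1; have := ltn_Fp a.
by case: (ltnP p.-1 a) => [|_ _]; [lia | rewrite muln0 add0n => ->; rewrite addnK].
Qed.

End Fp.

Lemma morphB_additive (U V : zmodType) (f : U -> V) :
  {morph f : x y / x - y} -> exists g : {additive U -> V}, g =1 f.
Proof.
move=> fB; pose m := GRing.isZmodMorphism.Build U V f fB.
by exists (HB.pack_for {additive U -> V} f m).
Qed.

(** * Additive maps from [F] to ['F_p] *)

Section AdditiveToFp.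
Variables (F : finFieldType) (p : nat) (p_pr : prime p).

Lemma additive_Fp_surj (f : {additive F -> 'F_p}) v c :
  f v != 0 -> exists x, f x = c.
Proof.
move=> fv0; exists (v *+ (c / f v)%R).
(* Taking natural multiples makes an additive map ['F_p]-linear, so its image is all of ['F_p] once
   it is nonzero. *)
by rewrite raddfMn -mulr_natr natr_Zp mulrC divfK.
Qed.

(** All [p] fibres are nonempty by surjectivity, and each is a translate of the kernel. *)
Lemma card_additive_Fp_ker (f : {additive F -> 'F_p}) v :
  f v != 0 -> (p * #|[set x | f x == 0%R]|)%N = #|F|.
Proof.
move=> fv0; transitivity (\sum_(c : 'F_p) #|[set x | f x == 0%R]|)%N.
  by rewrite sum_nat_const card_Fp.
rewrite -[RHS]cardsT -[RHS]sum1_card [RHS](partition_big f predT) //=.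
apply: eq_bigr => c _; have [u fu] := additive_Fp_surj c fv0.
rewrite sum1_card -[LHS](card_imset _ (addIr u)); apply: eq_card => x.
apply/imsetP/andP => [[y] | [_ /eqP fx]].
  by rewrite !inE => /eqP fy ->; rewrite raddfD fy fu add0r.
by exists (x - u); rewrite ?subrK // inE raddfB fx fu subrr.
Qed.

(* Double counting of the pairs [(a, x)] with [g (a * x) = f x]: each [x != 0]
   contributes [#|F| / p], and so does each [a] unless [f = g (a * _)]. *)
Lemma additive_Fp_scale (f g : {additive F -> 'F_p}) v :
  g v != 0 -> exists a, forall x, f x = g (a * x).
Proof.
move=> gv0; have p_gt1 := prime_gt1 p_pr.
pose k := #|[set x | g x == 0]|; have kE : (p * k)%N = #|F| := card_additive_Fp_ker gv0.
have [/existsP[a /forallP fa] | /existsPn no_a] :=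
    boolP [exists a, [forall x, f x == g (a * x)]].
  by exists a => x; apply/eqP.
have byx x : x != 0 -> #|[set a | f x == g (a * x)]| = k.
  move=> x0; have [u gu] := additive_Fp_surj (f x) gv0.
  have inj : injective (fun z => (z + u) / x).
    by move=> z z' /(mulIf (invr_neq0 x0)) /addIr.
  rewrite -[RHS](card_imset _ inj); apply: eq_card => a.
  rewrite !inE; apply/idP/imsetP => [/eqP fx | [y]].
    exists (a * x - u); rewrite ?subrK ?mulfK //.
    by rewrite inE raddfB gu fx subrr.
  by rewrite inE => /eqP gy ->; rewrite divfK // raddfD gy gu add0r.
have bya a : #|[set x | f x == g (a * x)]| = k.
  have [x fx] := forallPn (no_a a).
  have hB : {morph (fun x => f x - g (a * x)) : x y / x - y}.
    by move=> y z; rewrite /= mulrBr !raddfB addrACA.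
  have [d dE] := morphB_additive hB.
  apply/eqP; rewrite -(eqn_pmul2l (prime_gt0 p_pr)) kE.
  rewrite -(card_additive_Fp_ker (f := d) (v := x)) ?dE ?subr_eq0 //.
  apply/eqP; congr (_ * _)%N.
  by apply: eq_card => y; rewrite !inE dE subr_eq0.
have sumE : (\sum_x #|[set a | f x == g (a * x)%R]|
    = \sum_a #|[set x | f x == g (a * x)%R]|)%N.
  under eq_bigr do rewrite -sum1dep_card big_mkcond.
  under [RHS]eq_bigr do rewrite -sum1dep_card big_mkcond.
  exact: exchange_big.
move: sumE; rewrite (eq_bigr _ (fun a _ => bya a)).
rewrite (bigD1 0) //= (eq_bigr _ byx) !sum_nat_const.
have -> : #|[set a | f 0 == g (a * 0)]| = #|F|.
  by rewrite -cardsT; apply: eq_card => a; rewrite !inE mulr0 !raddf0 eqxx.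
have F_gt0 : (0 < #|F|)%N by apply/card_gt0P; exists 0.
have -> : #|[pred i : F | i != 0]| = #|F|.-1 by rewrite -(cardC1 0).
(* With [q = #|F|], the two counts give [q + (q - 1) k = q k], so [k = q], against [p k = q]. *)
rewrite -[#|xpredT|]/#|F| => eq_k; have k_eq : k = #|F| by nia.
by move: kE; rewrite k_eq; nia.
Qed.

End AdditiveToFp.

(** * Additivity and nontriviality of the absolute trace *)

Section Trace.
Variables (F : finFieldType) (p h : nat).
Hypotheses (p_pr : prime p) (card_F : #|F| = (p ^ h)%N).

Let pcharF : p \in [pchar F]. Proof. exact: card_finPcharP card_F p_pr. Qed.

(** The trace is characterised by its image in [F]; this injectivity brings identities back to
    ['F_p]. *)
Lemma natr_Fp_inj : injective (fun a : 'F_p => (a : nat)%:R : F).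
Proof.
move=> a b eq_ab; apply/eqP; rewrite -subr_eq0; apply/eqP/val_inj => /=.
have := Fp_borrow p_pr a b; have := ltn_Fp p_pr (a - b).
move=> lt_d /(congr1 (fun n => n%:R : F)).
rewrite !natrD natrM (pcharf0 pcharF) mul0r add0r eq_ab -[LHS]add0r => /addIr/esym/eqP.
rewrite -(dvdn_pcharf pcharF); have [// | d_gt0 /dvdn_leq] := posnP (a - b)%R.
by move=> /(_ d_gt0); rewrite leqNgt lt_d.
Qed.

Lemma absolute_traceB :
  {morph (absolute_trace p h : F -> 'F_p) : x y / x - y}.
Proof.
move=> x y; apply: natr_Fp_inj; rewrite (absolute_traceE p_pr card_F).
have := Fp_borrow p_pr (absolute_trace p h x) (absolute_trace p h y).
move=> /(congr1 (fun n => n%:R : F)).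
rewrite !natrD natrM (pcharf0 pcharF) mul0r add0r !(absolute_traceE p_pr card_F).
move=> /esym/(canRL (addrK _)) ->; rewrite /frobenius_sum -sumrB.
apply: eq_bigr => i _; apply: (canRL (addrK _)).
by rewrite -exprDn_pchar ?subrK // pnatX pnatE // pcharF.
Qed.

(** Otherwise a nonzero polynomial of degree at most [p ^ h.-1] would vanish on all [p ^ h] elements
    of [F]. *)
Lemma absolute_trace_neq0 : exists v : F, absolute_trace p h v != 0.
Proof.
have [/existsP // | /existsPn tr0] := boolP [exists v : F, absolute_trace p h v != 0].
have p_gt1 := prime_gt1 p_pr.
have h_gt0 : (0 < h)%N.
  by rewrite lt0n; apply/eqP => h0; have := finNzRing_gt1 F; rewrite card_F h0.
pose P : {poly F} := \sum_(i < h) 'X^(p ^ i).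
have rootP z : root P z.
  rewrite rootE /P horner_sum; under eq_bigr do rewrite hornerXn.
  rewrite -[X in X == 0]/(frobenius_sum p h z) -(absolute_traceE p_pr card_F).
  by have := tr0 z; rewrite negbK => /eqP ->.
have P_neq0 : P != 0.
  (* Only the summand [i = 0] contributes to the coefficient of ['X]. *)
  apply/eqP => /(congr1 (fun Q : {poly F} => Q`_1)); rewrite coef0 coef_sum.
  rewrite (bigD1 (Ordinal h_gt0)) //= coefXn expn0 eqxx big1 ?addr0 => [|i i0].
    by move/eqP; rewrite oner_eq0.
  rewrite -val_eqE /= -lt0n in i0.
  by rewrite coefXn ltn_eqF // (leq_ltn_trans i0) // ltn_expl.
have size_P : (size P <= (p ^ h.-1).+1)%N.
  apply: (leq_trans (size_sum _ _ _)); apply/bigmax_leqP => i _.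
  by rewrite size_polyXn ltnS leq_exp2l //; case: h i h_gt0 => // k [i] /=.
have := max_poly_roots P_neq0 (rs := enum F) _ (enum_uniq _).
rewrite -cardE card_F => /(_ _)/leq_trans/(_ size_P); rewrite ltnS.
rewrite leq_exp2l //; have -> : all (root P) (enum F) by apply/allP => z _.
by move=> /(_ isT); lia.
Qed.

End Trace.

(** * Parametrisation of lines and their intersection numbers *)

Section Lines.
Variable F : finFieldType.
Implicit Types (S : {set 'cV[F]_2}) (d : option F).

Definition point (x y : F) : 'cV[F]_2 := \col_i (if i == ord0 then x else y).

Lemma xcoord_point x y : xcoord (point x y) = x.
Proof. by rewrite /xcoord mxE. Qed.

Lemma ycoord_point x y : ycoord (point x y) = y.
Proof. by rewrite /ycoord mxE. Qed.

Lemma point_coord v : point (xcoord v) (ycoord v) = v.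
Proof.
apply/colP => i; rewrite mxE /xcoord /ycoord; case: eqP => [-> // | /eqP i0].
by congr (v _ _); apply/val_inj; case: i i0 => [[|[|]]].
Qed.

Definition intercept d (v : 'cV[F]_2) : F :=
  if d is Some m then ycoord v - m * xcoord v else xcoord v.

Lemma in_line d c v : (v \in line d c) = (intercept d v == c).
Proof. by case: d => [m|]; rewrite inE //= subr_eq addrC. Qed.

Definition line_point d c t : 'cV[F]_2 :=
  if d is Some m then point t (m * t + c) else point c t.

Lemma intercept_line_point d c t : intercept d (line_point d c t) = c.
Proof.
by case: d => [m|] /=; rewrite ?xcoord_point ?ycoord_point // addrC addKr.
Qed.

Lemma line_point_inj d c : injective (line_point d c).
Proof.
case: d => [m|] t t' /=.
  by move/(congr1 (@xcoord F)); rewrite !xcoord_point.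
by move/(congr1 (@ycoord F)); rewrite !ycoord_point.
Qed.

Lemma line_pointP d c v :
  reflect (exists t, v = line_point d c t) (v \in line d c).
Proof.
rewrite in_line; apply: (iffP eqP) => [<- | [t ->]]; last exact: intercept_line_point.
case: d => [m|] /=; [exists (xcoord v) | exists (ycoord v)]; rewrite ?point_coord //.
by rewrite addrC subrK point_coord.
Qed.

Lemma card_line_setI S d c :
  #|S :&: line d c| = (\sum_t (line_point d c t \in S))%N.
Proof.
rewrite -big_mkcond /= sum1dep_card -(card_imset _ (@line_point_inj d c)).
apply: eq_card => v; apply/setIP/imsetP => [[Sv /line_pointP[t vE]] | [t St ->]].
  by exists t; rewrite ?inE -?vE.
by rewrite inE in St; split=> //; apply/line_pointP; exists t.
Qed.

Lemma card_line_setI_le S d c : (#|S :&: line d c| <= #|F|)%N.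
Proof.
by rewrite card_line_setI -[leqRHS]sum1_card; apply: leq_sum => t _; case: (_ \in _).
Qed.

End Lines.

(** * The directions of the set defined by an additive map *)

Section AdditiveOrder.
Variables (F : finFieldType) (p : nat) (p_pr : prime p).
Variables (f : {additive F -> 'F_p}) (v : F) (fv0 : f v != 0).

Let L := [set w : 'cV[F]_2 | (f (xcoord w) < f (ycoord w))%N].
Let s := (\sum_x (f x : nat))%N.

Lemma sum_additive_Fp_affine a b : a != 0 -> (\sum_x (f (a * x + b)%R : nat))%N = s.
Proof.
move=> a0; rewrite /s [RHS](reindex (fun x => a * x + b)) //.
exists (fun y => (y - b) / a) => x _; first by rewrite addrK mulrC mulKf.
by rewrite mulrC divfK // subrK.
Qed.

Lemma card_line_additive_order d c :
  (p * #|L :&: line d c| +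
     \sum_t f (xcoord (line_point d c t))
   = \sum_t f (xcoord (line_point d c t) - ycoord (line_point d c t))%R +
     \sum_t f (ycoord (line_point d c t)))%N.
Proof.
rewrite card_line_setI big_distrr -!big_split /=; apply: eq_bigr => t _.
by rewrite inE raddfB Fp_borrow.
Qed.

(** Along a line each of [x], [y] and [x - y] is either constant or runs bijectively over [F], and
    in the latter case its sum is [s]. The three exceptional directions are those in which one of
    them is constant. *)
Lemma inequidistributed_additive_order :
  inequidistributed_directions L = [set Some 0; Some 1; None].
Proof.
have q_gt0 : (0 < #|F|)%N by apply/card_gt0P; exists 0.
have absurd k : k = (#|F| * 1)%N -> k = (#|F| * 0)%N -> False.
  by move=> ->; rewrite muln1 muln0; move: q_gt0; case: #|_|.
have p_gt1 := prime_gt1 p_pr.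
(* Equal counts on the lines where the constant quantity is [0] and [u] would give
   [#|F| * 0 = #|F| * 1]. *)
have [u fu] := additive_Fp_surj 1 fv0.
have f0 : f 0 = 0%N :> nat by rewrite raddf0.
have fu1 : f u = 1%N :> nat by rewrite fu (val_Fp_nat p_pr 1) modn_small.
apply/setP => d; rewrite !inE /inequidistributed /equidistributed.
have H c := card_line_additive_order d c.
have sum_const c : (\sum_(t : F) (f c : nat) = #|F| * f c)%N by rewrite sum_nat_const.
have ineq c1 c2 : #|L :&: line d c1| != #|L :&: line d c2| ->
    ~~ [forall c1, forall c2, #|L :&: line d c1| == #|L :&: line d c2|].
  by move=> ne; apply/forallPn; exists c1; apply/forallPn; exists c2.
case: d H ineq => [m|] H ineq; last first.
  rewrite eqxx orbT; apply: (ineq 0 u); apply/negP => /eqP eq_n.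
  have sumE c : (s + s - p * #|L :&: line None c| = #|F| * f c)%N.
    rewrite -sum_const.
    rewrite -[X in (X - _)%N](_ : p * #|L :&: line None c| + \sum_(t : F) f c = _)%N ?addKn //.
    have := H c; rewrite /=.
    under eq_bigr do rewrite xcoord_point.
    under [X in _ = (X + _)%N]eq_bigr do
      rewrite xcoord_point ycoord_point -mulN1r addrC.
    under [X in _ = (_ + X)%N]eq_bigr do rewrite ycoord_point.
    by rewrite sum_additive_Fp_affine // oppr_eq0 oner_eq0.
  by have := sumE u; have := sumE 0; rewrite -eq_n f0 fu1 => e0 /absurd; apply.
have -> : (Some m == None) = false by [].
rewrite !(inj_eq (@Some_inj _)) orbF.
have sumE c : (p * #|L :&: line (Some m) c| + s
    = \sum_t f ((1 - m) * t - c)%R + \sum_t f (m * t + c)%R)%N.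
  have := H c; rewrite /=.
  under eq_bigr do rewrite xcoord_point.
  under [X in _ = (X + _)%N]eq_bigr => t _ do
    rewrite xcoord_point ycoord_point opprD addrA -{1}[t]mul1r -mulrBl.
  by under [X in _ = (_ + X)%N]eq_bigr do rewrite ycoord_point.
have [m0 | m0] := eqVneq m 0.
  apply: (ineq 0 u); apply/negP => /eqP eq_n.
  have sumE0 c : (p * #|L :&: line (Some m) c| = #|F| * f c)%N.
    have := sumE c; rewrite (@sum_additive_Fp_affine (1 - m));
      last by rewrite m0 subr0 oner_eq0.
    have -> : (\sum_t f (m * t + c)%R = #|F| * f c)%N.
      by rewrite -sum_const; apply: eq_bigr => t _; rewrite m0 mul0r add0r.
    by rewrite [RHS]addnC => /addIn.
  by have := sumE0 u; have := sumE0 0; rewrite -eq_n f0 fu1 => e0 /absurd; apply.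
have [m1 | m1] := eqVneq m 1.
  apply: (ineq 0 (- u)); apply/negP => /eqP eq_n.
  (* On a line of slope 1, [x - y] is minus the intercept, hence the sign. *)
  have sumE1 c : (p * #|L :&: line (Some m) (- c)| = #|F| * f c)%N.
    have := sumE (- c); rewrite (@sum_additive_Fp_affine m) //.
    have -> : (\sum_t f ((1 - m) * t - - c)%R = #|F| * f c)%N.
      by rewrite -sum_const; apply: eq_bigr => t _; rewrite m1 subrr mul0r add0r opprK.
    by move/addIn.
  by have := sumE1 u; have := sumE1 0; rewrite oppr0 -eq_n f0 fu1 => e0 /absurd; apply.
apply/negbF/forallP => c1; apply/forallP => c2.
rewrite -(eqn_pmul2l (prime_gt0 p_pr)) -(eqn_add2r s) !sumE.
by rewrite !sum_additive_Fp_affine // subr_eq0 eq_sym.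
Qed.

End AdditiveOrder.

(** Without a carry [a + b = t - z] is at most [t]; with one, [a + b = t + (p - z)] exceeds [t]. *)
Lemma add_carry_threshold (p a b z t : nat) (carry : bool) :
  (z < p -> a + b + z = t + p * carry -> carry = (t < a + b) :> bool)%N.
Proof. by case: carry; lia. Qed.

(** * The Pexider equation modulo [q] *)

Section ThreeFunctions.
Variables (F : finFieldType) (p m : nat) (p_pr : prime p).
Hypotheses (pcharF : p \in [pchar F]) (m_gt0 : (0 < m)%N).
Local Notation q := (p * m)%N.

(** As [p] kills [F], [p * d x] is divisible by [q = p * m], hence [d x] by [m]; the quotient modulo
    [p] is additive. *)
Lemma additive_mod_Fp (d : F -> int) :
  (forall x y, (q %| d (x + y) - d x - d y)%Z) ->
  exists f : {additive F -> 'F_p}, forall x, (q %| d x - (m * f x)%N%:Z)%Z.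
Proof.
move=> dD; have pq : (p : int) * m = q by rewrite PoszM.
have d0 : (q %| d 0%R)%Z.
  have := dD 0 0; rewrite addr0 => /dvdzP[k e]; apply/dvdzP; exists (- k).
  by rewrite mulNr -e; ring.
have dMn x k : (q %| d (x *+ k) - d x * k%:Z)%Z.
  elim: k => [|k IH]; first by rewrite mulr0 subr0.
  have := rpredD (dD x (x *+ k)) IH; rewrite -mulrS.
  by congr (_ %| _)%Z; rewrite intS; ring.
have m_dvd x : exists e, d x = m%:Z * e.
  have := dMn x p; rewrite -mulr_natr (pcharf0 pcharF) mulr0.
  move/dvdzP: d0 => [k0 ->] /dvdzP[k1]; rewrite -pq => e1.
  exists (k0 - k1); apply: (mulfI (x := p%:Z)); first by have := prime_gt0 p_pr; lia.
  by apply/eqP; rewrite -subr_eq0; apply/eqP; move: e1; lia.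
pose e x := (d x %/ m)%Z; have dE x : d x = m%:Z * e x.
  by rewrite /e; have [k ->] := m_dvd x; rewrite mulKz //; lia.
have pE z : (p %| z)%Z = (z%:~R == 0 :> 'F_p) := dvdz_pcharf (pchar_Fp p_pr) z.
have cancel_m z : (q %| m%:Z * z)%Z -> (p %| z)%Z.
  move/dvdzP => [k]; rewrite -pq => ez; apply/dvdzP; exists k.
  by apply: (mulfI (x := m%:Z)); [lia | rewrite ez; ring].
have fB : {morph (fun x => (e x)%:~R : 'F_p) : x y / x - y}.
  move=> x y; apply/eqP; rewrite -subr_eq0 -!rmorphB /= -pE; apply: cancel_m.
  have := dD (x - y) y; rewrite subrK !dE -rpredN.
  by congr (_ %| _)%Z; ring.
have [f fE] := morphB_additive fB; exists f => x.
rewrite dE PoszM -mulrBr -pq mulrC; apply: dvdz_mul; last exact: dvdzz.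
by rewrite pE rmorphB /= -[X in _ - X]pmulrn natr_Zp fE subrr.
Qed.

(** With [x0] a minimum point of [n], the congruence fixes [n x] up to a multiple of [q], and the
    bounds allow only 0 or [q]. The latter forces the extreme values. *)
Lemma bounded_mod_additive (n : F -> nat) (f : {additive F -> 'F_p}) :
    (forall x, n x <= q)%N ->
    (forall x, (q %| (n x)%:Z - (n 0%R)%:Z - (m * f x)%N%:Z)%Z) ->
  exists x0, forall x, n x = (n x0 + m * f (x - x0)%R)%N \/
    [/\ n x = q, n x0 = 0%N & f (x - x0) = 0%R].
Proof.
move=> n_le nf; have [x0 _ x0_min] := @arg_minnP F 0 predT n isT.
exists x0 => x; have := nf x; have := nf x0; have := n_le x; have := x0_min x isT.
move=> n_ge nx_le /dvdzP[k0 e0] /dvdzP[k1 e1].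
have := Fp_borrow p_pr (f x) (f x0); rewrite -raddfB.
have := ltn_Fp p_pr (f (x - x0)).
set r : nat := nat_of_ord (f (x - x0)) => r_lt borrow.
have [j jE] : exists j : int, (n x)%:Z = (n x0)%:Z + m%:Z * r%:Z + j * q%:Z.
  (* The last term corrects for the borrow in [f x - f x0]. *)
  exists (k1 - k0 - (f x < f x0)%N%:Z); move: e0 e1 borrow; rewrite !PoszM.
  move: (n x)%:Z (n x0)%:Z (n 0) => a b c.
  move=> /(canRL (subrK _)) e0 /(canRL (subrK _)) e1 /(congr1 Posz).
  rewrite !PoszD PoszM => borrow.
  have : m%:Z * (p%:Z * (f x < f x0)%N%:Z + (f x : nat)%:Z)
      = m%:Z * (r%:Z + (f x0 : nat)%:Z).
    by rewrite borrow.
  by move: e0 e1 => /(canRL (subrK _)) -> /(canRL (subrK _)) ->; lia.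
have mr : (m * r + m <= q)%N by rewrite -mulnSr mulnC leq_mul2r r_lt orbT.
have j_ge : 0 <= j.
  have [//|j_lt] : 0 <= j \/ j <= -1 by lia.
  have : (j + 1) * q%:Z <= 0 by nia.
  by move: jE; rewrite -PoszM; lia.
have [j0 | [j1 | j_ge2]] : j = 0 \/ j = 1 \/ 2 <= j by lia.
- by left; move: jE; rewrite j0; lia.
- right; have : (m * r = 0)%N by move: jE; rewrite j1; lia.
  move/eqP; rewrite muln_eq0 => /orP[|/eqP r0]; first by lia.
  by split; [move: jE; rewrite j1 r0; lia .. | apply/val_inj].
- have : (2 - j) * q%:Z <= 0 by nia.
  by move: jE; lia.
Qed.

(** The hypotheses on full and empty values confine the ambiguity between [0] and [q] to [n1]. [C]
    lists the extra vertical lines: as [-1] has the largest representative, the order relation never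
    holds on them. *)
Lemma three_functions (n1 n2 n3 : F -> nat) (K : int) (P : F -> F -> bool) :
    (forall x, n1 x <= q)%N -> (forall x, n2 x <= q)%N -> (forall x, n3 x <= q)%N ->
    (forall x y, (n1 x + n2 y + n3 (y - x)%R)%N%:Z = K + (q * P x y)%N%:Z) ->
    (forall x x', n2 x = q -> n2 x' <> 0%N) ->
    (forall x x', n3 x = q -> n3 x' <> 0%N) ->
    (exists x x', n2 x <> n2 x') ->
  exists (f : {additive F -> 'F_p}) (v x0 y0 : F) (C : {set F}),
  [/\ f v != 0, forall x, x \in C -> f (x - x0) = -1 &
    forall x y, P x y = (f (x - x0)%R < f (y - y0)%R)%N || (x \in C)].
Proof.
move=> n1_le n2_le n3_le nP n2_bad n3_bad [z1 [z2 n2_z]].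
pose d x := (n2 x)%:Z - (n2 0)%:Z.
have nP' x y : exists k, (n1 x)%:Z + (n2 y)%:Z + (n3 (y - x))%:Z = K + k * q%:Z.
  by exists (P x y)%:Z; have := nP x y; rewrite !PoszD => ->; rewrite PoszM mulrC.
(* The pairs [(x, x)], [(0, x)] and [(x, x + y)], each compared with [(0, 0)], give in turn the
   variation of [n1], that of [n3], and the additivity of [d] modulo [q]. *)
have n1d x : exists k, (n1 x)%:Z - (n1 0)%:Z = - d x + k * q%:Z.
  have [k0] := nP' 0 0; have [k1] := nP' x x; rewrite !subrr /d => e1 e0.
  by exists (k1 - k0); lia.
have n3d x : exists k, (n3 x)%:Z - (n3 0)%:Z = - d x + k * q%:Z.
  have [k0] := nP' 0 0; have [k1] := nP' 0 x; rewrite !subr0 /d => e1 e0.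
  by exists (k1 - k0); lia.
have dD x y : (q %| d (x + y)%R - d x - d y)%Z.
  have [k0] := nP' 0 0; rewrite subrr; have [k1] := nP' x (x + y); have [k2] := n1d x.
  have [k3] := n3d y; rewrite [x + y - x]addrAC subrr add0r /d => e3 e2 e1 e0.
  apply/dvdzP; exists (k1 - k0 - k2 - k3).
  move: (n2 (x + y)) (n2 x) (n2 y) (n2 0)
    (n1 x) (n1 0) (n3 y) (n3 0) (p * m)%N e0 e1 e2 e3.
  by clear => *; lia.
have [f fE] := additive_mod_Fp dD.
have [g gE] := @morphB_additive F 'F_p (fun x => - f x)
  (fun x y => ltac:(by rewrite /= raddfB opprD)).
have gd (n : F -> nat) :
    (forall x, exists k, (n x)%:Z - (n 0)%:Z = - d x + k * q%:Z) ->
    forall x, (q %| (n x)%:Z - (n 0%R)%:Z - (m * g x)%N%:Z)%Z.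
  move=> nd x; have [k ->] := nd x; have /dvdzP[k'] := fE x.
  rewrite gE val_FpN //; case: eqP => [-> | _] e.
    by apply/dvdzP; exists (k - k'); move: e; rewrite muln0; lia.
  have := ltn_Fp p_pr (f x) => fx_lt.
  by apply/dvdzP; exists (k - k' - 1); move: e; rewrite mulnBr PoszM; nia.
have [x0 n1E] := bounded_mod_additive n1_le (gd _ n1d).
have [y0 n2E] := bounded_mod_additive n2_le fE.
have [z0 n3E] := bounded_mod_additive n3_le (gd _ n3d).
have {}n2E y : n2 y = (n2 y0 + m * f (y - y0)%R)%N.
  by case: (n2E y) => // -[/n2_bad n2q n20]; case: (n2q y0).
have {}n3E z : n3 z = (n3 z0 + m * g (z - z0)%R)%N.
  by case: (n3E z) => // -[/n3_bad n3q n30]; case: (n3q z0).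
have [v fv] : exists v, f v != 0.
  have [f1 | f1] := eqVneq (f (z1 - y0)) 0; last by exists (z1 - y0).
  exists (z2 - y0); apply/eqP => f2; apply: n2_z.
  by rewrite (n2E z1) (n2E z2) f1 f2.
pose C := [set x | n1 x != n1 x0 + m * g (x - x0)%R]%N.
have CE x : x \in C -> [/\ n1 x = q, n1 x0 = 0%N & f (x - x0) = 0].
  rewrite inE => /eqP nx; have [// | [n1x n1x0 gx]] := n1E x; split=> //.
  by apply/eqP; rewrite -oppr_eq0 -gE gx.
have nCE x : x \notin C -> n1 x = (n1 x0 + m * g (x - x0)%R)%N.
  by rewrite inE negbK => /eqP.
have x0C : x0 \notin C by rewrite inE subrr raddf0 muln0 addn0 eqxx.
(* This is [g (y0 - x0 - z0)], the third residue at [(x0, y0)]. Comparing [(x, y)] with that point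
   eliminates [K] and the minima. *)
pose t := f x0 - f y0 + f z0.
pose Z x y := t - f (x0 - x) - f (y - y0).
have gx x : g (x - x0) = f (x0 - x) by rewrite gE -raddfN opprB.
have gz x y : g (y - x - z0) = Z x y.
  by rewrite gE /Z /t -raddfN -(raddfB f x0) -(raddfD f) -!(raddfB f); congr (f _); ring.
have f0 : f 0 = 0 := raddf0 f.
have Z0 : Z x0 y0 = t by rewrite /Z !subrr f0 !subr0.
have rE x y : x \notin C ->
    (f (x0 - x)%R + f (y - y0)%R + Z x y + p * P x0 y0 = t + p * P x y)%N.
  move=> xC; have := nP x y; have := nP x0 y0.
  rewrite (nCE x xC) (n2E y) (n3E (y - x)) (n3E (y0 - x0)) gx !gz.
  rewrite Z0 => e0 e.
  apply/eqP; rewrite -(eqn_pmul2l m_gt0); apply/eqP.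
  move: e0 e; move: (n1 x0) (n2 y0) (n3 z0) (nat_of_ord (f (x0 - x))).
  move: (nat_of_ord (f (y - y0))) (nat_of_ord (Z x y)) (nat_of_ord t).
  by move: (P x y : nat) (P x0 y0 : nat); clear => *; lia.
have [u fu] := additive_Fp_surj (-1) fv.
have t_ub := ltn_Fp p_pr t.
have p_gt1 := prime_gt1 p_pr.
have N1_neq0 : -1 != 0 :> 'F_p by rewrite oppr_eq0 oner_eq0.
(* At [f (x0 - x) = f (y - y0) = -1] the left-hand side of [rE] is at least
   [2 p - 2], which leaves only [t = p - 1] and [t = p - 2]. *)
have [P0 t_lb] : P x0 y0 = false /\ (p <= t.+2)%N.
  have uC : x0 - u \notin C.
    by apply/negP => /CE[_ _ /eqP]; rewrite addrAC subrr add0r raddfN fu opprK oner_eq0.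
  have := rE (x0 - u) (y0 + u) uC.
  rewrite opprB addrC subrK [y0 + u]addrC addrK fu val_FpN1 //.
  by case: (P x0 y0) (P _ _) => [] []; lia.
have PE x y : x \notin C -> P x y = (t < f (x0 - x)%R + f (y - y0)%R)%N.
  move=> xC; have := rE x y xC; rewrite P0 muln0 addn0.
  exact: add_carry_threshold (ltn_Fp p_pr _).
(* Replacing [x0] by [x] in [C] raises [n1] from [0] to [q] and keeps the other terms, so [P] must
   pass from false to true. *)
have PC x y : x \in C -> P x y /\ (f (y - y0)%R <= t)%N.
  move=> xC; have [n1x n1x0 fx] := CE x xC.
  have fx0 : f (x0 - x) = 0 by rewrite -opprB raddfN fx oppr0.
  have Px0 : P x0 y = (t < f (y - y0)%R)%N by rewrite PE // subrr f0.
  have ZE : Z x y = Z x0 y by rewrite /Z fx0 subrr f0.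
  have := nP x y; have := nP x0 y.
  rewrite n1x n1x0 (n3E (y - x)) (n3E (y - x0)) !gz ZE leqNgt -Px0.
  move: (n2 y) (n3 z0) (m * Z x0 y)%N; have := prime_gt0 p_pr; move: m_gt0.
  by case: (P x y); case: (P x0 y) => //=; clear; nia.
have [t_max | t_max] : t = p.-1 :> nat \/ t = p.-2 :> nat by lia.
(* Write [a = f (x0 - x)] and [b = f (y - y0)]. The shift by [u] turns [p - 1 < a + b] into
   [p - 1 - a < b]. *)
- exists f, v, (x0 - u), y0, C; split=> // [x /CE[_ _ fx] | x y].
    by rewrite opprB addrA [x + u]addrC -addrA raddfD fx fu addr0.
  have [xC | xC] := boolP (x \in C); first by rewrite orbT; case: (PC x y xC).
  rewrite orbF PE // t_max.
  have -> : f (x - (x0 - u)) = - 1 - f (x0 - x) by rewrite -fu -raddfB; congr (f _); ring.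
  rewrite val_FpN1B //; have := ltn_Fp p_pr (f (x0 - x)).
  by move: (nat_of_ord _) (nat_of_ord _); clear; lia.
- have C0 x : x \notin C.
    apply/negP => xC; have [_] := PC x (y0 + u) xC.
    by rewrite addrC addKr fu val_FpN1 //; lia.
  (* Now [p - 2 < a + b] becomes [p - 2 - a < b] after shifting twice. For [a = p - 1] it always
     holds, while the shifted value wraps around to [-1]; these columns form the new [C]. *)
  exists f, v, (x0 - u - u), y0, [set x | f (x - (x0 - u - u)) == -1].
  split=> // [x | x y]; first by rewrite inE => /eqP.
  rewrite inE PE // t_max.
  have -> : f (x - (x0 - u - u)) = - 1 + (- 1 - f (x0 - x)).
    by rewrite -fu -raddfB -raddfD; congr (f _); ring.
  have := ltn_Fp p_pr (f (x0 - x)); have := ltn_Fp p_pr (f (y - y0)).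
  rewrite -[X in _ || X]subr_eq0 addrAC subrr add0r.
  rewrite -[X in _ || X]val_eqE [val _](val_FpN1B p_pr) val_FpD //.
  rewrite val_FpN1B // val_FpN1 //.
  move: p_gt1 (nat_of_ord _) (nat_of_ord _); clear=> /= p_gt1 a b.
  by case: (ltnP (p.-1 + _)); case: eqP; lia.
Qed.

End ThreeFunctions.

(** * Pencils of lines and linear coordinates adapted to directions *)

Section Directions.
Variable F : finFieldType.
Implicit Types (S : {set 'cV[F]_2}) (d : option F) (v w : 'cV[F]_2).

Lemma intercept_meet d d' c c' : d != d' ->
  exists v, intercept d v = c /\ intercept d' v = c'.
Proof.
case: d d' => [m|] [m'|] // ne.
- have mm : m' - m != 0.
    by rewrite subr_eq0; apply: contraNneq ne => ->.
  pose x := (c - c') / (m' - m); exists (point x (c + m * x)).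
  rewrite /= xcoord_point ycoord_point addrK; split=> //.
  have -> : c + m * x - m' * x = c - x * (m' - m) by ring.
  by rewrite /x divfK //; ring.
- by exists (point c' (c + m * c')); rewrite /= xcoord_point ycoord_point addrK.
- by exists (point c (c' + m' * c)); rewrite /= xcoord_point ycoord_point addrK.
Qed.

Lemma card_directions_join v w :
  #|[set d | intercept d w == intercept d v]| = if w == v then #|F|.+1 else 1%N.
Proof.
case: eqVneq => [-> | ne].
  by rewrite -card_option -cardsT; apply: eq_card => d; rewrite !inE eqxx.
have [x_eq | x_ne] := eqVneq (xcoord w) (xcoord v).
  apply/eqP/cards1P; exists None; apply/setP => -[m|]; rewrite !inE /= x_eq ?eqxx //.
  apply/negP => /eqP/addIr y_eq; case/eqP: ne.
  by rewrite -[w]point_coord x_eq y_eq point_coord.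
have dx : xcoord w - xcoord v != 0 by rewrite subr_eq0.
pose m0 := (ycoord w - ycoord v) / (xcoord w - xcoord v).
apply/eqP/cards1P; exists (Some m0); apply/setP => -[m|]; rewrite !inE /=; last first.
  by rewrite (negbTE x_ne).
rewrite (inj_eq (@Some_inj _)) /m0 eq_sym -subr_eq0 -[in RHS](inj_eq (mulIf dx)) divfK //.
by rewrite -[in RHS]subr_eq0; congr (_ == 0); ring.
Qed.

(** Double counting of pairs of a direction and a point of [S] on the line through [v]: [v] itself
    lies on all [#|F| + 1] lines, any other point on one. *)
Lemma sum_card_lines_through S v :
  (\sum_d #|S :&: line d (intercept d v)| = #|S| + #|F| * (v \in S))%N.
Proof.
transitivity (\sum_(w in S) #|[set d | intercept d w == intercept d v]|)%N.
  under [RHS]eq_bigr do rewrite -sum1dep_card big_mkcond.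
  rewrite exchange_big; apply: eq_bigr => d _; rewrite -sum1_card -big_mkcondr.
  by apply: eq_bigl => w; rewrite inE in_line.
under eq_bigr do rewrite card_directions_join.
rewrite -sum1_card; have [vS | vS] := boolP (v \in S).
  rewrite (bigD1 v) //= eqxx [X in (_ = X + _)%N](bigD1 v) //=.
  under eq_bigr => w /andP[_ /negPf wv] do rewrite wv.
  by lia.
rewrite muln0 addn0; apply: eq_bigr => w wS.
by case: eqP => // wv; rewrite -wv wS in vS.
Qed.

Lemma full_line S d v : #|S :&: line d (intercept d v)| = #|F| -> v \in S.
Proof.
move=> full; have : S :&: line d (intercept d v) == line d (intercept d v).
  by rewrite eqEcard subsetIr full -[leqLHS]/#|_| -(setTI (line d _)) card_line_setI_le.
by move=> /eqP/setP/(_ v); rewrite inE in_line eqxx andbT.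
Qed.

Definition has_full_and_empty_lines S d :=
  [exists c, #|S :&: line d c| == #|F|] && [exists c, #|S :&: line d c| == 0%N].

Lemma full_and_empty_lines_unique S d d' :
  has_full_and_empty_lines S d -> has_full_and_empty_lines S d' -> d = d'.
Proof.
move=> /andP[/existsP[c /eqP full] _] /andP[_ /existsP[c' /eqP empty]].
apply/eqP; apply/negP => /negP ne; have [v [vc vc']] := intercept_meet c c' ne.
have vS : v \in S by apply: (@full_line _ d); rewrite vc.
move/eqP: empty; rewrite cards_eq0 => /eqP/setP/(_ v).
by rewrite !inE in_line vS vc' eqxx.
Qed.

(** Three linear forms on a plane are dependent, and pairwise independence makes the coefficients
    nonzero. Rescaling the first two forms turns the third into [y - x]. *)
Lemma three_intercepts d1 d2 d3 : d1 != d2 -> d1 != d3 -> d2 != d3 ->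
  exists a b, [/\ a != 0, b != 0 &
    forall v, intercept d3 v = b * intercept d2 v - a * intercept d1 v].
Proof.
case: d1 d2 d3 => [m1|] [m2|] [m3|] //; rewrite ?(inj_eq (@Some_inj _)) => n12 n13 n23.
- have m21 : m2 - m1 != 0 by rewrite subr_eq0 eq_sym.
  exists ((m3 - m2) / (m2 - m1)), ((m3 - m1) / (m2 - m1)).
  split=> [||v /=]; last by field.
    by rewrite mulf_neq0 ?invr_eq0 // subr_eq0 eq_sym.
  by rewrite mulf_neq0 ?invr_eq0 // subr_eq0 eq_sym.
- have m12 : m1 - m2 != 0 by rewrite subr_eq0.
  by exists ((m1 - m2)^-1), ((m1 - m2)^-1); split=> [||v /=]; rewrite ?invr_eq0 //; field.
- exists (- 1), (m1 - m3); split=> [||v /=]; last by ring.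
    by rewrite oppr_eq0 oner_eq0.
  by rewrite subr_eq0.
- exists (m3 - m2), 1; split=> [||v /=]; last by ring.
    by rewrite subr_eq0 eq_sym.
  exact: oner_neq0.
Qed.

Definition intercept_coef d (j : 'I_2) : F :=
  if d is Some m then (if j == 0 then - m else 1) else (if j == 0 then 1 else 0).

Definition frame_mx d1 d2 (a b : F) : 'M[F]_2 :=
  \matrix_(i, j) (if i == 0 then a * intercept_coef d1 j else b * intercept_coef d2 j).

Lemma frame_mxE d1 d2 a b v :
  frame_mx d1 d2 a b *m v = point (a * intercept d1 v) (b * intercept d2 v).
Proof.
have lin d : intercept d v =
    intercept_coef d 0 * xcoord v + intercept_coef d ord_max * ycoord v.
  by case: d => [m|] /=; ring.
apply/colP => i; rewrite !mxE big_ord_recl big_ord1 !mxE.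
have -> : lift ord0 ord0 = ord_max :> 'I_2 by apply/val_inj.
rewrite !lin -/(xcoord v) -/(ycoord v).
by case: ifP => _; rewrite mulrDr !mulrA.
Qed.

Lemma frame_mx_unit d1 d2 a b : d1 != d2 -> a != 0 -> b != 0 ->
  frame_mx d1 d2 a b \in unitmx.
Proof.
move=> n12 a0 b0; rewrite unitmxE unitfE (expand_det_row _ 0).
rewrite big_ord_recl big_ord1 /cofactor !det_mx11 !mxE /=.
case: d1 d2 n12 => [m1|] [m2|] //=; rewrite ?(inj_eq (@Some_inj _)) => n12.
- rewrite [X in X != 0](_ : _ = a * b * (m2 - m1)); last by ring.
  by rewrite !mulf_neq0 // subr_eq0 eq_sym.
- rewrite [X in X != 0](_ : _ = - (a * b)); last by ring.
  by rewrite oppr_eq0 mulf_neq0.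
- rewrite [X in X != 0](_ : _ = a * b); last by ring.
  by rewrite mulf_neq0.
Qed.

End Directions.

(** * Reduction of a set with three directions to the trace set *)

Section Classification.
Variables (F : finFieldType) (p h : nat) (p_pr : prime p) (card_F : #|F| = (p ^ h)%N).
Variable S : {set 'cV[F]_2}.

Lemma inequidistributed_neq d : d \in inequidistributed_directions S ->
  exists c c', #|S :&: line d c| <> #|S :&: line d c'|.
Proof.
by rewrite inE => /forallPn[c /forallPn[c' /eqP ne]]; exists c, c'.
Qed.

(* At most one direction has both a full and an empty line; it is put first. *)
Lemma three_directions : #|inequidistributed_directions S| = 3%N ->
  exists d1 d2 d3, [/\ uniq [:: d1; d2; d3],
    inequidistributed_directions S = [set d1; d2; d3],
    ~~ has_full_and_empty_lines S d2 & ~~ has_full_and_empty_lines S d3].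
Proof.
set D := inequidistributed_directions S => D3.
have [d1 dD d1_bad] : exists2 d1, d1 \in D &
    forall d, d \in D -> d != d1 -> ~~ has_full_and_empty_lines S d.
  have [/existsP[d /andP[dD d_bad]] | /existsPn no_bad] :=
      boolP [exists d, (d \in D) && has_full_and_empty_lines S d].
    exists d => // d' _ ne; apply: contraNN ne => d'_bad.
    by rewrite (full_and_empty_lines_unique d'_bad d_bad).
  have [d dD] : exists d, d \in D by apply/card_gt0P; rewrite D3.
  by exists d => // d' d'D _; have := no_bad d'; rewrite d'D.
have : #|D :\ d1| == 2%N by have := cardsD1 d1 D; rewrite dD D3 add1n => -[<-].
move/cards2P => [d2 [d3 [n23 DE]]].
have : d2 \in D :\ d1 by rewrite DE set21.
have : d3 \in D :\ d1 by rewrite DE set22.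
rewrite !inE => /andP[n31 d3D] /andP[n21 d2D]; exists d1, d2, d3; split.
- by rewrite /= !inE negb_or n23 ![d1 == _]eq_sym n21 n31.
- by rewrite -(setD1K dD) DE setUA.
- by apply: d1_bad; rewrite ?inE.
- by apply: d1_bad; rewrite ?inE.
Qed.

Lemma three_directions_classification :
    #|inequidistributed_directions S| = 3%N ->
  exists T : {set 'cV[F]_2},
    union_with_disjoint_parallel_lines (trace_set F p h) T /\ affinely_equivalent S T.
Proof.
move=> /three_directions[d1 [d2 [d3 [uniq_d DE d2_good d3_good]]]].
move: (uniq_d); rewrite /= !inE negb_or andbT => /andP[/andP[n12 n13] n23].
have [al [be [al0 be0 i3]]] := three_intercepts n12 n13 n23.
pose M := frame_mx d1 d2 al be.
have Mu : M \in unitmx by apply: frame_mx_unit.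
have ME v : M *m v = point (al * intercept d1 v) (be * intercept d2 v) :=
  frame_mxE _ _ _ _ _.
pose m := (p ^ h.-1)%N.
have p_gt0 := prime_gt0 p_pr.
have m_gt0 : (0 < m)%N by rewrite expn_gt0 p_gt0.
have qE : #|F| = (p * m)%N.
  rewrite card_F /m; case: h card_F => [cF|k _]; last by rewrite expnS.
  by have := finNzRing_gt1 F; rewrite cF.
have pcharF : p \in [pchar F] := card_finPcharP card_F p_pr.
pose N d c := #|S :&: line d c|.
pose P x y := invmx M *m point x y \in S.
(* The intercept [0] may stand for any other, since these directions are equidistributed. *)
pose K : int := #|S|%:Z -
  (\sum_(d | d \notin inequidistributed_directions S) N d 0%R)%N%:Z.
have N_le d c : (N d c <= p * m)%N by rewrite -qE card_line_setI_le.
have sumN v : (N d1 (intercept d1 v) + N d2 (intercept d2 v) + N d3 (intercept d3 v))%N%:Z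
    = K + (p * m * (v \in S))%N%:Z.
  have const d : d \notin inequidistributed_directions S -> N d (intercept d v) = N d 0.
    by rewrite inE negbK => /forallP/(_ (intercept d v))/forallP/(_ 0)/eqP.
  have := sum_card_lines_through S v.
  rewrite (bigID (mem (inequidistributed_directions S))) /= (eq_bigr _ const).
  rewrite {1}DE -setUA big_setU1 ?inE ?negb_or ?n12 // big_setU1 ?inE // big_set1.
  rewrite -qE /K /= addnA -!/(N _ _).
  move: (N d1 _ + N d2 _ + N d3 _)%N (\sum_(_ | _) _)%N (#|F| * _)%N #|S|.
  by clear; lia.
have good d : ~~ has_full_and_empty_lines S d ->
    forall c c', N d c = (p * m)%N -> N d c' <> 0%N.
  move=> d_good c c' full empty; case/negP: d_good.
  by apply/andP; split; apply/existsP; [exists c | exists c']; apply/eqP; rewrite ?qE.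
have frame x y (v := invmx M *m point x y) :
    x = al * intercept d1 v /\ y = be * intercept d2 v.
  have : M *m v = point x y by rewrite /v mulKVmx.
  rewrite ME => e; have := congr1 (@xcoord F) e; have := congr1 (@ycoord F) e.
  by rewrite !xcoord_point !ycoord_point.
have NP x y : (N d1 (x / al) + N d2 (y / be) + N d3 (y - x)%R)%N%:Z
    = K + (p * m * P x y)%N%:Z.
  have [xE yE] := frame x y; rewrite /P; set v := invmx M *m point x y in xE yE *.
  have -> : y - x = intercept d3 v by rewrite i3 -xE -yE.
  have -> : x / al = intercept d1 v by rewrite xE mulrC mulKf.
  have -> : y / be = intercept d2 v by rewrite yE mulrC mulKf.
  exact: sumN.
have nonconst : exists y y', N d2 (y / be) <> N d2 (y' / be).
  have [|c [c' ne]] := @inequidistributed_neq d2; first by rewrite DE !inE eqxx orbT.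
  by exists (c * be), (c' * be); rewrite !mulfK.
have [f [u [x0 [y0 [C [fu fC PE]]]]]] := three_functions p_pr pcharF m_gt0
    (fun x => N_le d1 (x / al)) (fun y => N_le d2 (y / be)) (N_le d3)
    NP (fun x x' => good _ d2_good _ _) (good _ d3_good) nonconst.
have [tr trE] := morphB_additive (absolute_traceB p_pr card_F).
have [w trw] : exists w, tr w != 0.
  by have [w] := absolute_trace_neq0 p_pr card_F; exists w; rewrite trE.
have [a fa] := additive_Fp_scale p_pr f trw.
have a0 : a != 0.
  by apply: contraNneq fu => a0; rewrite fa a0 mul0r raddf0.
pose C' := [set a * (x - x0) | x in C].
(* [M] sends [d1], [d2], [d3] to the directions [None], [Some 0], [Some 1]; scaling by [a] turns [f]
   into the trace, and the translation absorbs [x0] and [y0]. *)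
pose phi v := (a *: M) *m v + point (- (a * x0)) (- (a * y0)).
have phiE v : phi v =
    point (a * (al * intercept d1 v - x0)) (a * (be * intercept d2 v - y0)).
  rewrite /phi -scalemxAl ME; apply/colP => i; rewrite !mxE.
  by case: ifP => _; ring.
have aMu : a *: M \in unitmx by rewrite unitmxZ ?unitfE.
have injX : injective (fun x => a * (x - x0)) by move=> x x' /(mulfI a0)/addIr.
have LE v : (phi v \in trace_set F p h) =
    (f (al * intercept d1 v - x0)%R < f (be * intercept d2 v - y0)%R)%N.
  by rewrite inE phiE xcoord_point ycoord_point !fa !trE.
exists (trace_set F p h :|: \bigcup_(c in C') line None c); split.
  exists None, C'; split=> // _ /imsetP[x xC ->].
  rewrite disjoint_subset; apply/subsetP => v; rewrite in_line => /eqP /= xv.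
  (* On these lines the trace of the abscissa is [p - 1], which no trace exceeds. *)
  rewrite !inE xv -trE -fa fC // val_FpN1 // -leqNgt.
  by rewrite -ltnS prednK // ltn_Fp.
exists (a *: M), (point (- (a * x0)) (- (a * y0))); split=> //.
have phi_inj : injective phi by move=> v v' /addIr /(can_inj (mulKmx aMu)).
apply/setP => v'; have [v ->] : exists v, v' = phi v.
  exists (invmx (a *: M) *m (v' - point (- (a * x0)) (- (a * y0)))).
  by rewrite /phi mulKVmx // subrK.
rewrite [RHS]mem_imset // in_setU LE.
have -> : (phi v \in \bigcup_(c in C') line None c) = (al * intercept d1 v \in C).
  rewrite -(mem_imset _ _ injX) -/C'; apply/bigcupP/idP => [[c cC'] | ?].
    by rewrite in_line /= phiE xcoord_point => /eqP ->.
  by exists (a * (al * intercept d1 v - x0)); rewrite // in_line /= phiE xcoord_point.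
by rewrite -PE /P -ME mulKmx.
Qed.

End Classification.


Theorem theorem1p10 (p h : nat) (F : finFieldType)
    (p_prime : prime p) (card_F : #|F| = (p ^ h)%N) :
  inequidistributed_directions (trace_set F p h)
    = [set Some (0 : F); Some (1 : F); None]
  /\
  (forall S : {set 'cV[F]_2},
     #|inequidistributed_directions S| = 3%N ->
     exists T : {set 'cV[F]_2},
       union_with_disjoint_parallel_lines (trace_set F p h) T /\
       affinely_equivalent S T).
Proof.
split; last exact: three_directions_classification.
have [tr trE] := morphB_additive (absolute_traceB p_prime card_F).
have [v trv] : exists v, tr v != 0.
  by have [v] := absolute_trace_neq0 p_prime card_F; exists v; rewrite trE.
rewrite -(inequidistributed_additive_order p_prime trv).
congr inequidistributed_directions.
by apply/setP => w; rewrite !inE !trE.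
Qed.
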